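(* Let $\mathbf{T}$ be a $\mathbb{C}$-linear triangulated category of finite type and let $\{E_0,\ldots,E_n\}$ be a complete Ext-exceptional collection on $\mathbf{T}$. Then $\langle E_0,\ldots,E_n\rangle$ is the heart of a bounded $t$-structure on $\mathbf{T}$.
   Context: A $\mathbb{C}$-linear triangulated category $\mathbf{T}$ is of finite type if $\bigoplus_{k\in\mathbb{Z}}\mathrm{Hom}^k(A,B)$ is finite-dimensional for all $A,B$, where $\mathrm{Hom}^k(A,B)=\mathrm{Hom}(A,B[k])$. An object $E$ is exceptional if $\mathrm{Hom}^i(E,E)=0$ for $i\neq 0$ and $\mathrm{Hom}^0(E,E)=\mathbb{C}$. An ordered collection $\{E_0,\ldots,E_n\}$ of exceptional objects is an exceptional collection if $\mathrm{Hom}^k(E_i,E_j)=0$ for all $k$ whenever $i>j$. It is Ext (Ext-exceptional) if $\mathrm{Hom}^{k}(E_i,E_j)=0$ for all $i\neq j$ and all $k\le 0$; it is complete if it generates $\mathbf{T}$ by shifts and extensions. For a set $S$ of objects, $\langle S\rangle$ denotes the extension-closed (full) subcategory of $\mathbf{T}$ generated by $S$. *)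

(* Defs.v *)
From mathcomp Require Import all_boot all_order all_algebra.
From mathcomp Require Import reals complex.

Set Implicit Arguments.
Unset Strict Implicit.
Unset Printing Implicit Defensive.

Import GRing.Theory.
Local Open Scope ring_scope.

Reserved Notation "g \oc f" (at level 40, left associativity).

(** * Linear categories and functors *)

Record linCat (K : fieldType) := LinCat {
  obj :> Type;
  mor : obj -> obj -> lmodType K;
  idm : forall X, mor X X;
  comp : forall X Y Z, mor Y Z -> mor X Y -> mor X Z;
  comp_idl : forall X Y (f : mor X Y), comp (idm Y) f = f;
  comp_idr : forall X Y (f : mor X Y), comp f (idm X) = f;
  compA : forall W X Y Z (h : mor Y Z) (g : mor X Y) (f : mor W X),
    comp h (comp g f) = comp (comp h g) f;
  comp_linearr : forall X Y Z (g : mor Y Z), linear (@comp X Y Z g);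
  comp_linearl : forall X Y Z (f : mor X Y),
    linear (fun g : mor Y Z => comp g f)
}.

Arguments mor {K l} X Y.
Arguments idm {K l} X.
Arguments comp {K l X Y Z} g f.

Notation "g \oc f" := (comp g f) : ring_scope.

Section LinCatNotions.
Variables (K : fieldType) (T : linCat K).
Implicit Types X Y Z : T.

Definition is_iso X Y (f : mor X Y) : Prop :=
  exists g : mor Y X, g \oc f = idm X /\ f \oc g = idm Y.

Definition is_zero Z : Prop :=
  forall X, (forall f : mor Z X, f = 0) /\ (forall f : mor X Z, f = 0).

Definition is_biproduct X Y S (i1 : mor X S) (i2 : mor Y S)
    (p1 : mor S X) (p2 : mor S Y) : Prop :=
  [/\ p1 \oc i1 = idm X, p2 \oc i2 = idm Y, p1 \oc i2 = 0, p2 \oc i1 = 0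
    & i1 \oc p1 + i2 \oc p2 = idm S].

Definition additive_cat : Prop :=
  (exists Z, is_zero Z) /\
  (forall X Y, exists S (i1 : mor X S) (i2 : mor Y S)
     (p1 : mor S X) (p2 : mor S Y), is_biproduct i1 i2 p1 p2).

Record linEndofunctor := LinEndofunctor {
  fobj :> T -> T;
  fmap : forall X Y, mor X Y -> mor (fobj X) (fobj Y);
  fmap_id : forall X, fmap (idm X) = idm (fobj X);
  fmap_comp : forall X Y Z (g : mor Y Z) (f : mor X Y),
    fmap (g \oc f) = fmap g \oc fmap f;
  fmap_linear : forall X Y, linear (@fmap X Y)
}.

(* [F] and [G] are mutually quasi-inverse: [id ~ F G] and [G F ~ id]. *)
Definition quasi_inverse (F G : linEndofunctor) : Prop :=
  (exists eta : forall X, mor X (F (G X)),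
     (forall X, is_iso (eta X)) /\
     (forall X Y (f : mor X Y), eta Y \oc f = fmap F (fmap G f) \oc eta X)) /\
  (exists eps : forall X, mor (G (F X)) X,
     (forall X, is_iso (eps X)) /\
     (forall X Y (f : mor X Y), eps Y \oc fmap G (fmap F f) = f \oc eps X)).

End LinCatNotions.

Arguments fmap {K T} l {X Y} f.

(** * Triangulated categories *)

(* The translation functor is only required to be an autoequivalence, with a
   chosen quasi-inverse; a strict automorphism is a special case. *)
Record triCat (K : fieldType) := TriCat {
  tri_cat :> linCat K;
  tri_additive : additive_cat tri_cat;
  shf : linEndofunctor tri_cat;
  unshf : linEndofunctor tri_cat;
  shf_equiv : quasi_inverse shf unshf;
  dist : forall X Y Z : tri_cat,
    mor X Y -> mor Y Z -> mor Z (shf X) -> Prop;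
  (* TR1 *)
  dist_iso : forall (X Y Z X' Y' Z' : tri_cat)
      (f : mor X Y) (g : mor Y Z) (h : mor Z (shf X))
      (f' : mor X' Y') (g' : mor Y' Z') (h' : mor Z' (shf X'))
      (a : mor X X') (b : mor Y Y') (c : mor Z Z'),
    is_iso a -> is_iso b -> is_iso c ->
    b \oc f = f' \oc a -> c \oc g = g' \oc b ->
    fmap shf a \oc h = h' \oc c ->
    dist f g h -> dist f' g' h';
  dist_id : forall X Z : tri_cat, is_zero Z ->
    dist (idm X) (0 : mor X Z) (0 : mor Z (shf X));
  dist_cone : forall (X Y : tri_cat) (f : mor X Y),
    exists Z (g : mor Y Z) (h : mor Z (shf X)), dist f g h;
  (* TR2 *)
  dist_rot : forall (X Y Z : tri_cat)
      (f : mor X Y) (g : mor Y Z) (h : mor Z (shf X)),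
    dist f g h <-> dist g h (- fmap shf f);
  (* TR3 *)
  dist_mor : forall (X Y Z X' Y' Z' : tri_cat)
      (f : mor X Y) (g : mor Y Z) (h : mor Z (shf X))
      (f' : mor X' Y') (g' : mor Y' Z') (h' : mor Z' (shf X'))
      (a : mor X X') (b : mor Y Y'),
    dist f g h -> dist f' g' h' -> b \oc f = f' \oc a ->
    exists c : mor Z Z', c \oc g = g' \oc b /\ h' \oc c = fmap shf a \oc h;
  (* TR4, the octahedral axiom *)
  dist_oct : forall (X Y Z Z' X' Y' : tri_cat) (f : mor X Y) (g : mor Y Z)
      (f1 : mor Y Z') (f2 : mor Z' (shf X))
      (g1 : mor Z X') (g2 : mor X' (shf Y))
      (h1 : mor Z Y') (h2 : mor Y' (shf X)),
    dist f f1 f2 -> dist g g1 g2 -> dist (g \oc f) h1 h2 ->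
    exists (u : mor Z' Y') (v : mor Y' X'),
      [/\ dist u v (fmap shf f1 \oc g2),
          u \oc f1 = h1 \oc g, h2 \oc u = f2,
          v \oc h1 = g1 & g2 \oc v = fmap shf f \oc h2]
}.

Section TriCatNotions.
Variables (K : fieldType) (T : triCat K).
Implicit Types (X Y A B : T) (k : int) (P S : T -> Prop).

Definition sh k X : T :=
  match k with
  | Posz m => iter m (shf T) X
  | Negz m => iter m.+1 (unshf T) X
  end.

Definition mork k A B : lmodType K := mor A (sh k B).

Definition mork_zero k A B : Prop := forall f : mork k A B, f = 0.

(* An element of the direct sum of the [mork k A B], [k : int], is a family
   with finite support. *)
Definition fin_supp A B (f : forall k, mork k A B) : Prop :=
  exists s : seq int, forall k, k \notin s -> f k = 0.

Definition finite_type : Prop :=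
  forall A B, exists (d : nat) (b : 'I_d -> forall k, mork k A B),
    (forall i, fin_supp (b i)) /\
    (forall f : forall k, mork k A B, fin_supp f ->
       exists c : 'I_d -> K, forall k, f k = \sum_(i < d) c i *: b i k).

(** ** Subcategories *)

(* Full subcategories are given by predicates on objects. An extension-closed
   subcategory is understood to contain the zero objects (the empty
   extensions); closure under isomorphism is then automatic, because an
   isomorphism [A -> X] sits in a distinguished triangle [A -> X -> 0]. *)
Definition extension_closed P : Prop :=
  (forall Z, is_zero Z -> P Z) /\
  (forall A X B (f : mor A X) (g : mor X B) (h : mor B (shf T A)),
     dist f g h -> P A -> P B -> P X).

Definition shift_closed P : Prop := forall k X, P X -> P (sh k X).

Definition ext_hull S X : Prop :=
  forall P, extension_closed P -> (forall Y, S Y -> P Y) -> P X.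

Definition tri_hull S X : Prop :=
  forall P, extension_closed P -> shift_closed P ->
    (forall Y, S Y -> P Y) -> P X.

(** ** Exceptional collections *)

Definition exceptional A : Prop :=
  (forall k, k != 0 -> mork_zero k A A) /\
  (exists phi : {linear mork 0 A A -> K^o}, bijective phi).

Section Collections.
Variables (n : nat) (E : 'I_n.+1 -> T).

Definition members X : Prop := exists i, X = E i.

Definition exceptional_collection : Prop :=
  (forall i, exceptional (E i)) /\
  (forall i j : 'I_n.+1, (j < i)%N -> forall k, mork_zero k (E i) (E j)).

Definition ext_exceptional_collection : Prop :=
  exceptional_collection /\
  (forall i j, i != j -> forall k, k <= 0 -> mork_zero k (E i) (E j)).

Definition complete_collection : Prop := forall X, tri_hull members X.

End Collections.

(** ** t-structures *)

Definition iso_closed P : Prop :=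
  forall X Y (f : mor X Y), is_iso f -> P X -> P Y.

(* [P[-k]]: for [P] the aisle [D^{<=0}] (resp. [D^{>=0}]) this is [D^{<=k}]
   (resp. [D^{>=k}]). *)
Definition unshift k P X : Prop := P (sh k X).

(* Cohomological convention: [tle0] is [D^{<=0}] and [tge0] is [D^{>=0}]. *)
Record t_structure := TStructure {
  tle0 : T -> Prop;
  tge0 : T -> Prop;
  tle0_iso : iso_closed tle0;
  tge0_iso : iso_closed tge0;
  tle0_sub : forall X, tle0 X -> unshift 1 tle0 X;
  tge0_sub : forall X, unshift 1 tge0 X -> tge0 X;
  t_orth : forall X Y, tle0 X -> unshift 1 tge0 Y -> forall f : mor X Y, f = 0;
  t_trunc : forall X, exists A B (f : mor A X) (g : mor X B)
      (h : mor B (shf T A)),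
    [/\ dist f g h, tle0 A & unshift 1 tge0 B]
}.

Definition heart (t : t_structure) X : Prop := tle0 t X /\ tge0 t X.

Definition bounded (t : t_structure) : Prop :=
  forall X, exists a b : int, unshift a (tge0 t) X /\ unshift b (tle0 t) X.

Definition is_bounded_heart P : Prop :=
  exists t : t_structure, bounded t /\ (forall X, P X <-> heart t X).

End TriCatNotions.

(* Main.v *)
Require Import Defs.
From mathcomp Require Import all_boot all_order all_algebra.
From mathcomp Require Import reals complex.
From mathcomp Require boolp.
From mathcomp Require Import zify.
Import Defs.

(** Let [D^{<=0}] and [D^{>=0}] be the extension closures of the translates
   [E_i[k]] with [k >= 0] and [k <= 0] respectively. Since negative [Hom]s
   between members of the collection vanish, there is no nonzero map from
   [D^{<=0}] to [D^{>=1}], so the point is to truncate every object.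

   Completeness makes every object an iterated extension of translates
   [E_i[k]], in some order; truncating means moving the factors with [k >= 0]
   in front of those with [k < 0]. Consider two neighbouring factors in the
   wrong order, [A = E_j[l]] before [B = E_i[k]] with [l < k]. Their extension
   is classified by a map [B -> A[1]], an element of [Hom^{l+1-k}(E_i, E_j)]
   with [l + 1 - k <= 0]. By hypothesis this group vanishes unless [i = j] and
   [k = l + 1], and then it consists of the scalars. So either the map is zero,
   the extension splits and the two factors can be exchanged, or the map is
   invertible and the two factors cancel. This local move
   ([star_exchange_gen]) propagates through iterated extensions by
   associativity of the product of classes of objects ([star_assocl],
   [star_assocr]: the octahedral axiom), which yields [ext_hull_star]:
   ext (H union L) is contained in (ext H) * (ext L) when [L] is closed under
   isomorphism and every map from an object of [H] to the translate of an
   object of [L] is zero or invertible.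

   The heart is found by the same sorting, now separating [k >= 1] from
   [k = 0] in an object [X] of [D^{<=0}]: if [X] is also in [D^{>=0}], the part
   with [k >= 1] maps to [X] by zero, which forces it to vanish
   ([hull_heart]). Boundedness holds because an iterated extension involves
   only finitely many translates. *)

Set Implicit Arguments.
Unset Strict Implicit.
Unset Printing Implicit Defensive.

Import GRing.Theory.
Local Open Scope ring_scope.
Local Open Scope complex_scope.

(** * Linear categories *)

Section LinearCategory.
Variables (K : fieldType) (T : linCat K).
Implicit Types X Y Z W : T.

Lemma linear_map0 (U V : lmodType K) (f : U -> V) : linear f -> f 0 = 0.
Proof.
move=> lf; have := lf (-1) 0 0.
by rewrite scaler0 addr0 scaleN1r addNr.
Qed.

Lemma linear_mapN (U V : lmodType K) (f : U -> V) :
  linear f -> {morph f : u / - u}.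
Proof.
move=> lf u; have := lf (-1) u 0.
by rewrite !scaleN1r !addr0 (linear_map0 lf) addr0.
Qed.

Lemma linear_mapB (U V : lmodType K) (f : U -> V) :
  linear f -> {morph f : u v / u - v}.
Proof.
move=> lf u v; have := lf (-1) v u.
by rewrite !scaleN1r [- v + u]addrC [- f v + f u]addrC.
Qed.

Lemma linear_mapZ (U V : lmodType K) (f : U -> V) a :
  linear f -> {morph f : u / a *: u}.
Proof.
by move=> lf u; have := lf a u 0; rewrite !addr0 (linear_map0 lf) addr0.
Qed.

Lemma comp0r X Y Z (g : mor Y Z) : g \oc (0 : mor X Y) = 0.
Proof. exact: linear_map0 (comp_linearr g). Qed.

Lemma comp0l X Y Z (f : mor X Y) : (0 : mor Y Z) \oc f = 0.
Proof. exact: linear_map0 (comp_linearl f). Qed.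

Lemma compNr X Y Z (g : mor Y Z) (f : mor X Y) : g \oc (- f) = - (g \oc f).
Proof. exact: linear_mapN (comp_linearr g) f. Qed.

Lemma compNl X Y Z (g : mor Y Z) (f : mor X Y) : (- g) \oc f = - (g \oc f).
Proof. exact: linear_mapN (comp_linearl f) g. Qed.

Lemma compBr X Y Z (g : mor Y Z) (f f' : mor X Y) :
  g \oc (f - f') = g \oc f - g \oc f'.
Proof. exact: linear_mapB (comp_linearr g) f f'. Qed.

Lemma compBl X Y Z (g g' : mor Y Z) (f : mor X Y) :
  (g - g') \oc f = g \oc f - g' \oc f.
Proof. exact: linear_mapB (comp_linearl f) g g'. Qed.

Lemma compZr X Y Z a (g : mor Y Z) (f : mor X Y) :
  g \oc (a *: f) = a *: (g \oc f).
Proof. exact: linear_mapZ a (comp_linearr g) f. Qed.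

Lemma compZl X Y Z a (g : mor Y Z) (f : mor X Y) :
  (a *: g) \oc f = a *: (g \oc f).
Proof. exact: linear_mapZ a (comp_linearl f) g. Qed.

Lemma is_iso_id X : is_iso (idm X).
Proof. by exists (idm X); rewrite comp_idl. Qed.

Lemma is_iso_comp X Y Z (g : mor Y Z) (f : mor X Y) :
  is_iso g -> is_iso f -> is_iso (g \oc f).
Proof.
move=> [g' [g'g gg']] [f' [f'f ff']]; exists (f' \oc g'); split.
  by rewrite compA -(compA f') g'g comp_idr.
by rewrite compA -(compA g) ff' comp_idr.
Qed.

Lemma is_isoN X Y (f : mor X Y) : is_iso f -> is_iso (- f).
Proof.
by move=> [g [gf fg]]; exists (- g); rewrite !compNl !compNr !opprK.
Qed.

Lemma is_isoZ X Y a (f : mor X Y) : a != 0 -> is_iso f -> is_iso (a *: f).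
Proof.
move=> a0 [g [gf fg]]; exists (a^-1 *: g).
by rewrite !compZl !compZr !scalerA divff // mulVf // !scale1r.
Qed.

Lemma is_iso_two_sided X Y (f : mor X Y) (g g' : mor Y X) :
  is_iso (g \oc f) -> is_iso (f \oc g') -> is_iso f.
Proof.
move=> [u [u1 _]] [v [_ v2]].
have l : (u \oc g) \oc f = idm X by rewrite -compA.
have r : f \oc (g' \oc v) = idm Y by rewrite compA.
exists (u \oc g); split=> //.
suff -> : u \oc g = g' \oc v by [].
by rewrite -[LHS]comp_idr -r compA l comp_idl.
Qed.

Definition isomorphic X Y := exists f : mor X Y, is_iso f.

Lemma isomorphic_refl X : isomorphic X X.
Proof. by exists (idm X); apply: is_iso_id. Qed.

Lemma isomorphic_sym X Y : isomorphic X Y -> isomorphic Y X.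
Proof. by move=> [f [g [gf fg]]]; exists g, f. Qed.

Lemma isomorphic_trans Y X Z :
  isomorphic X Y -> isomorphic Y Z -> isomorphic X Z.
Proof.
by move=> [f fi] [g gi]; exists (g \oc f); apply: is_iso_comp.
Qed.

Lemma is_zero_id Z : idm Z = 0 -> is_zero Z.
Proof.
move=> z X; split=> f.
  by rewrite -[f]comp_idr z comp0r.
by rewrite -[f]comp_idl z comp0l.
Qed.

Lemma is_zero_iso X Y : isomorphic X Y -> is_zero X -> is_zero Y.
Proof.
move=> [f [g [_ fg]]] z; apply: is_zero_id.
by rewrite -fg (proj1 (z _) f) comp0l.
Qed.

Definition no_mor A B := forall f : mor (l := T) A B, f = 0.

Definition mor0_or_iso A B := forall f : mor (l := T) A B, f = 0 \/ is_iso f.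

Lemma no_mor_iso A A' B B' :
  isomorphic A A' -> isomorphic B B' -> no_mor A B -> no_mor A' B'.
Proof.
move=> [a [a' [a'a aa']]] [b [b' [b'b bb']]] z f.
have := z (b' \oc f \oc a) => /(congr1 (fun g => b \oc g \oc a')).
rewrite comp0r comp0l compA -compA aa' comp_idr.
by rewrite compA bb' comp_idl.
Qed.

Lemma mor0_or_iso_iso A A' B B' :
  isomorphic A A' -> isomorphic B B' -> mor0_or_iso A B -> mor0_or_iso A' B'.
Proof.
move=> [a ai] [b bi] z f.
have [a' [a'a aa']] := ai; have [b' [b'b bb']] := bi.
have <- : b \oc (b' \oc f \oc a) \oc a' = f.
  by rewrite compA -compA aa' comp_idr compA bb' comp_idl.
have [->|i] := z (b' \oc f \oc a); first by left; rewrite comp0r comp0l.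
by right; apply: is_iso_comp; [exact: is_iso_comp|exists a].
Qed.

End LinearCategory.

(** * Equivalences *)

Section Equivalence.
Variables (K : fieldType) (T : linCat K).
Implicit Types (F G : linEndofunctor T) (X Y : T).

Lemma fmap0 F X Y : fmap F (0 : mor X Y) = 0.
Proof. exact: linear_map0 (fmap_linear F (X := X) (Y := Y)). Qed.

Lemma fmapN F X Y (f : mor X Y) : fmap F (- f) = - fmap F f.
Proof. exact: linear_mapN (fmap_linear F (X := X) (Y := Y)) f. Qed.

Lemma fmap_iso F X Y (f : mor X Y) : is_iso f -> is_iso (fmap F f).
Proof.
by move=> [g [gf fg]]; exists (fmap F g); rewrite -!fmap_comp gf fg !fmap_id.
Qed.

Lemma fobj_isomorphic F X Y : isomorphic X Y -> isomorphic (F X) (F Y).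
Proof. by move=> [f fi]; exists (fmap F f); apply: fmap_iso. Qed.

Lemma fobj_zero F X : is_zero X -> is_zero (F X).
Proof.
by move=> z; apply: is_zero_id; rewrite -fmap_id (proj1 (z _) (idm X)) fmap0.
Qed.

(** One half of an equivalence, oriented so that each half can be used in turn
   with the two functors exchanged. *)
Definition left_quasi_inverse F G :=
  exists eps : forall X, mor (G (F X)) X,
    (forall X, is_iso (eps X)) /\
    (forall X Y (f : mor X Y), eps Y \oc fmap G (fmap F f) = f \oc eps X).

Lemma quasi_inverse_left F G :
  quasi_inverse F G -> left_quasi_inverse F G /\ left_quasi_inverse G F.
Proof.
move=> [[eta [etai eta_nat]] eps]; split=> //.
pose inv X := projT1 (boolp.cid (etai X)).
have invP X : inv X \oc eta X = idm X /\ eta X \oc inv X = idm _.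
  by rewrite /inv; case: boolp.cid.
exists inv; split=> [X|X Y f]; first by exists (eta X); case: (invP X).
rewrite -[LHS]comp_idr -(proj2 (invP X)) compA -(compA (inv Y)) -eta_nat.
by rewrite compA (proj1 (invP Y)) comp_idl.
Qed.

Section LeftQuasiInverse.
Variables F G : linEndofunctor T.
Hypothesis FG : left_quasi_inverse F G.

Lemma left_quasi_inverse_iso X : isomorphic (G (F X)) X.
Proof. by case: FG => eps [epsi _]; exists (eps X). Qed.

Lemma fmap_faithful X Y (f g : mor X Y) : fmap F f = fmap F g -> f = g.
Proof.
case: FG => eps [epsi nat] e; have [r [_ er]] := epsi X.
by rewrite -[f]comp_idr -[g]comp_idr -er !compA -!nat e.
Qed.

Lemma fmap_reflects_iso X Y (f : mor X Y) : is_iso (fmap F f) -> is_iso f.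
Proof.
case: FG => eps [epsi nat] i; have [r [re er]] := epsi X.
rewrite -[f]comp_idr -er compA -nat; apply: is_iso_comp; last by exists (eps X).
by apply: is_iso_comp => //; apply: fmap_iso.
Qed.

Lemma fobj_reflects_zero X : is_zero (F X) -> is_zero X.
Proof.
by move=> /(fobj_zero G); apply: is_zero_iso; apply: left_quasi_inverse_iso.
Qed.

End LeftQuasiInverse.

Section FullyFaithful.
Variables F G : linEndofunctor T.
Hypotheses (FG : left_quasi_inverse F G) (GF : left_quasi_inverse G F).

(** Apply [G], conjugate by [G F ~ id], and compare using that [G] is
   faithful. *)
Lemma fmap_full X Y (f : mor (F X) (F Y)) : exists g : mor X Y, fmap F g = f.
Proof.
have [eps [epsi nat]] := FG.
have [r [re er]] := epsi X; have [s [se es]] := epsi Y.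
exists (eps Y \oc fmap G f \oc r); apply: (fmap_faithful GF).
rewrite -[LHS]comp_idl -se -compA nat.
by rewrite -!compA re comp_idr compA se comp_idl.
Qed.

Lemma fobj_reflects_isomorphic X Y : isomorphic (F X) (F Y) -> isomorphic X Y.
Proof.
move=> [f fi]; have [g e] := fmap_full f.
by exists g; apply: (fmap_reflects_iso FG); rewrite e.
Qed.

Lemma no_mor_fobj X Y : no_mor X Y -> no_mor (F X) (F Y).
Proof. by move=> z f; have [g <-] := fmap_full f; rewrite (z g) fmap0. Qed.

Lemma mor0_or_iso_fobj X Y : mor0_or_iso X Y -> mor0_or_iso (F X) (F Y).
Proof.
move=> z f; have [g <-] := fmap_full f.
by have [->|i] := z g; [left; rewrite fmap0|right; apply: fmap_iso].
Qed.

End FullyFaithful.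
End Equivalence.

(** * Triangles *)

Section Triangulated.
Variables (K : fieldType) (T : triCat K).
Implicit Types A B C X Y Z W : T.

Local Notation S := (shf T).
Local Notation U := (unshf T).

Lemma shfK : left_quasi_inverse S U.
Proof. by case: (quasi_inverse_left (shf_equiv T)). Qed.

Lemma unshfK : left_quasi_inverse U S.
Proof. by case: (quasi_inverse_left (shf_equiv T)). Qed.

Lemma dist_rot1 X Y Z (f : mor X Y) (g : mor Y Z) (h : mor Z (S X)) :
  dist f g h -> dist g h (- fmap S f).
Proof. by move/dist_rot. Qed.

Lemma dist_id0 X Z : is_zero Z -> dist (0 : mor Z X) (idm X) (0 : mor X (S Z)).
Proof.
move=> z; apply/dist_rot; rewrite fmap0 oppr0; apply: dist_id.
exact: fobj_zero.
Qed.

Lemma dist_comp0 X Y Z (f : mor X Y) (g : mor Y Z) (h : mor Z (S X)) :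
  dist f g h -> g \oc f = 0.
Proof.
move=> d; have [[O zO] _] := tri_additive T.
have [c [<- _]] := dist_mor (a := idm X) (b := f) (dist_id X zO) d erefl.
exact: comp0r.
Qed.

(** Exactness of [mor _ W], obtained by mapping the triangle to
   [0 -> W -> W]. *)
Lemma dist_factor_out X Y Z W (f : mor X Y) (g : mor Y Z) (h : mor Z (S X))
    (u : mor Y W) :
  dist f g h -> u \oc f = 0 -> exists v : mor Z W, u = v \oc g.
Proof.
move=> d e; have [[O zO] _] := tri_additive T.
have [|c [cg _]] := dist_mor (a := 0 : mor X O) (b := u) d
  (dist_id0 W zO); first by rewrite comp0l.
by exists c; rewrite cg comp_idl.
Qed.

(** Exactness of [mor W _]: rotating makes the factorization appear after one
   translation, and full faithfulness brings it back. *)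
Lemma dist_factor_in X Y Z W (f : mor X Y) (g : mor Y Z) (h : mor Z (S X))
    (u : mor W Y) :
  dist f g h -> g \oc u = 0 -> exists v : mor W X, u = f \oc v.
Proof.
move=> d e; have [[O zO] _] := tri_additive T.
have [|c [_]] := dist_mor (a := u) (b := 0 : mor O Z) (dist_rot1 (dist_id W zO))
   (dist_rot1 d); first by rewrite comp0l e.
have [v <-] := fmap_full shfK unshfK c.
rewrite fmap_id compNl compNr comp_idr => /oppr_inj.
by rewrite -fmap_comp => /(fmap_faithful shfK) <-; exists v.
Qed.

(** Such an endomorphism [c] differs from the identity by some [v \oc h], and
   this difference squares to zero because [h \oc c = h]. *)
Lemma dist_endo_iso X Y Z (f : mor X Y) (g : mor Y Z) (h : mor Z (S X))
    (c : mor Z Z) :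
  dist f g h -> c \oc g = g -> h \oc c = h -> is_iso c.
Proof.
move=> d cg hc.
have [|v e] := dist_factor_out (u := c - idm Z) (dist_rot1 d).
  by rewrite compBl comp_idl cg subrr.
have sq : (c - idm Z) \oc (c - idm Z) = 0.
  by rewrite {1}e -compA compBr comp_idr hc subrr comp0r.
have ec : c = idm Z - - (c - idm Z) by rewrite opprK [idm Z + _]addrC subrK.
move: (c - idm Z) ec sq => w -> sq; exists (idm Z - w).
rewrite !compBl !compBr !comp_idl !comp_idr compNl compNr sq oppr0 !subr0.
by rewrite opprK addrK subrK.
Qed.

(** The triangulated five lemma. The fill-ins for [(a, b)] and for its inverse
   compose to endomorphisms of the kind treated in [dist_endo_iso]. *)
Lemma dist_mor_iso X Y Z X' Y' Z'
    (f : mor X Y) (g : mor Y Z) (h : mor Z (S X))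
    (f' : mor X' Y') (g' : mor Y' Z') (h' : mor Z' (S X'))
    (a : mor X X') (b : mor Y Y') :
  dist f g h -> dist f' g' h' -> is_iso a -> is_iso b -> b \oc f = f' \oc a ->
  exists c : mor Z Z',
    [/\ is_iso c, c \oc g = g' \oc b & h' \oc c = fmap S a \oc h].
Proof.
move=> d d' [a' [a'a aa']] [b' [b'b bb']] e.
have e' : b' \oc f' = f \oc a'.
  by rewrite -[LHS]comp_idr -aa' compA -(compA b') -e compA b'b comp_idl.
have [c [cg hc]] := dist_mor d d' e.
have [c' [c'g hc']] := dist_mor d' d e'.
exists c; split=> //; apply: (is_iso_two_sided (g := c') (g' := c')).
- apply: (dist_endo_iso d).
    by rewrite -compA cg compA c'g -compA b'b comp_idr.
  by rewrite compA hc' -compA hc compA -fmap_comp a'a fmap_id comp_idl.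
- apply: (dist_endo_iso d').
    by rewrite -compA c'g compA cg -compA bb' comp_idr.
  by rewrite compA hc -compA hc' compA -fmap_comp aa' fmap_id comp_idl.
Qed.

(** Three rotations change all three signs; conjugating the middle object by
   [-1] leaves only the sign of the last map. *)
Lemma dist_shf X Y Z (f : mor X Y) (g : mor Y Z) (h : mor Z (S X)) :
  dist f g h -> dist (fmap S f) (fmap S g) (- fmap S h).
Proof.
move=> /dist_rot1 /dist_rot1 /dist_rot1.
apply: (dist_iso (a := idm _) (b := - idm _) (c := idm _));
  rewrite ?fmap_id ?compNl ?compNr ?comp_idl ?comp_idr ?opprK //.
- exact: is_iso_id.
- exact/is_isoN/is_iso_id.
- exact: is_iso_id.
Qed.

(** By the five lemma the translated triangle is isomorphic to the translate of
   the triangle built on [f], and the isomorphism descends because [S] is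
   fully faithful. *)
Lemma dist_shf_reflect X Y Z (f : mor X Y) (g : mor Y Z) (h : mor Z (S X)) :
  dist (fmap S f) (fmap S g) (- fmap S h) -> dist f g h.
Proof.
move=> d; have [Z' [g' [h' d']]] := dist_cone f.
have [|c [ci cg hc]] := dist_mor_iso (a := idm _) (b := idm _) (dist_shf d') d
  (is_iso_id _) (is_iso_id _); first by rewrite comp_idl comp_idr.
have [c0 e] := fmap_full shfK unshfK c.
move: ci cg hc; rewrite -{}e comp_idr fmap_id comp_idl compNl.
move=> /(fmap_reflects_iso shfK) ci.
rewrite -!fmap_comp => /(fmap_faithful shfK) cg /oppr_inj.
move=> /(fmap_faithful shfK) hc.
apply: (dist_iso (is_iso_id X) (is_iso_id Y) ci _ _ _ d').
- by rewrite comp_idl comp_idr.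
- by rewrite comp_idr.
- by rewrite fmap_id comp_idl hc.
Qed.

(** The quasi-inverse of the translation inherits exactness: [S] detects
   distinguished triangles, and [S] of the candidate is isomorphic to the
   original triangle. *)
Lemma dist_unshf X Y Z (f : mor X Y) (g : mor Y Z) (h : mor Z (S X)) :
  dist f g h -> exists h', dist (fmap U f) (fmap U g) h'.
Proof.
move=> d; have [[eta [etai nat]] _] := shf_equiv T.
have [r [re _]] := etai Z.
have [h' e] := fmap_full shfK unshfK (fmap S (eta X) \oc h \oc r).
exists (- h'); apply: dist_shf_reflect; rewrite fmapN opprK e.
apply: (dist_iso (etai X) (etai Y) (etai Z) _ _ _ d) => //.
by rewrite -compA re comp_idr.
Qed.

Lemma dist_cocone Y Z (g : mor Y Z) : exists X (f : mor X Y) h, dist f g h.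
Proof.
have [W [h [k d]]] := dist_cone g.
have [s [si _]] := unshfK.
have [t [ts st]] := si W.
have [f e] := fmap_full shfK unshfK (- k \oc s W).
exists (U W), f, (t \oc h); apply/dist_rot.
apply: (dist_iso (is_iso_id Y) (is_iso_id Z) (c := t) _ _ _ _ d).
- by exists (s W).
- by rewrite comp_idl comp_idr.
- by rewrite comp_idr.
- by rewrite fmap_id comp_idl e !compNl opprK -compA st comp_idr.
Qed.

Lemma dist_cocone0_iso A X B (f : mor A X) (g : mor X B) (h : mor B (S A)) :
  dist f g h -> is_zero A -> is_iso g.
Proof.
move=> d z.
have [|c [ci cg _]] :=
  dist_mor_iso (dist_id0 X z) d (is_iso_id _) (is_iso_id _).
  by rewrite comp0r (proj1 (z _) f) comp0l.
by rewrite -[g]comp_idr -cg comp_idr.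
Qed.

Lemma dist_cone0_iso A X B (f : mor A X) (g : mor X B) (h : mor B (S A)) :
  dist f g h -> is_zero B -> is_iso f.
Proof.
move=> d z.
apply: (fmap_reflects_iso shfK); rewrite -[fmap _ f]opprK; apply: is_isoN.
exact: (dist_cocone0_iso (dist_rot1 (dist_rot1 d)) z).
Qed.

(** The cancelling case of the exchange: consecutive maps compose to zero, so
   an invertible [h] forces [f = 0] and [g = 0]. *)
Lemma dist_mor_iso_cone0 A X B (f : mor A X) (g : mor X B) (h : mor B (S A)) :
  dist f g h -> is_iso h -> is_zero X.
Proof.
move=> d [k [kh hk]].
have g0 : g = 0.
  by rewrite -[g]comp_idl -kh -compA (dist_comp0 (dist_rot1 d)) comp0r.
have f0 : f = 0.
  apply: (fmap_faithful shfK); rewrite fmap0 -[LHS]comp_idr -hk compA.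
  have := dist_comp0 (dist_rot1 (dist_rot1 d)).
  by rewrite compNl => /eqP; rewrite oppr_eq0 => /eqP ->; rewrite comp0l.
have [|v e] := dist_factor_in (u := idm X) d; first by rewrite g0 comp0l.
by apply: is_zero_id; rewrite e f0 comp0l.
Qed.

(** ** Extensions *)

(** The products of classes of objects used by Beilinson, Bernstein and
   Deligne: [star P Q] consists of the extensions of an object of [Q] by an
   object of [P]. *)
Definition star (P Q : T -> Prop) X :=
  exists A B (f : mor A X) (g : mor X B) h, [/\ dist f g h, P A & Q B].

Lemma star_mono (P P' Q Q' : T -> Prop) :
  (forall X, P X -> P' X) -> (forall X, Q X -> Q' X) ->
  forall X, star P Q X -> star P' Q' X.
Proof.
move=> PP QQ X [A [B [f [g [h [d PA QB]]]]]].
by exists A, B, f, g, h; split; auto.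
Qed.

(** The octahedral axiom for the composite [A -> Y -> X]. *)
Lemma star_assocl (P Q R : T -> Prop) X :
  star (star P Q) R X -> star P (star Q R) X.
Proof.
move=> [Y [C [g [g1 [g2 [dg [A [B [f [f1 [f2 [df PA QB]]]]]] RC]]]]]].
have [W [h1 [h2 dh]]] := dist_cone (g \oc f).
have [u [v [duv _ _ _ _]]] := dist_oct df dg dh.
exists A, W, (g \oc f), h1, h2; split=> //.
by exists B, C, u, v; eexists; split; [exact: duv| |].
Qed.

(** The octahedral axiom for the composite [X -> Y -> C], read backwards: the
   cones are the translates of [A], [B] and of the sought extension of [B] by
   [A]. *)
Lemma star_assocr (P Q R : T -> Prop) X :
  star P (star Q R) X -> star (star P Q) R X.
Proof.
move=> [A [Y [i [f [f1 [df PA [B [C [j [g [g1 [dg QB RC]]]]]]]]]]]].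
have [W [k [k1 dk]]] := dist_cocone (g \oc f).
have [u [v [duv _ _ _ _]]] :=
  dist_oct (dist_rot1 df) (dist_rot1 dg) (dist_rot1 dk).
have [u0 eu] := fmap_full shfK unshfK u.
have [v0 ev] := fmap_full shfK unshfK v.
set w := _ \oc _ in duv; have [w0 ew] := fmap_full shfK unshfK (- w).
exists W, C, k, (g \oc f), k1; split=> //.
exists A, B, u0, v0, w0; split=> //.
by apply: dist_shf_reflect; rewrite eu ev ew opprK.
Qed.

(** The splitting case of the exchange: if the connecting map vanishes then [g]
   has a section [s], and the octahedral axiom for [g \oc s = idm B] identifies
   the cone of [s] with [A]. *)
Lemma dist_split_swap A X B (f : mor A X) (g : mor X B) :
  dist f g 0 -> exists C, isomorphic A C /\
    exists (s : mor B X) (p : mor X C) h, dist s p h.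
Proof.
move=> d.
have [|s es] := dist_factor_in (u := idm B) (dist_rot1 d).
  by rewrite comp0l.
have [C [p [q ds]]] := dist_cone s.
have [[O zO] _] := tri_additive T.
have [|u [v [duv _ _ _ _]]] :=
  dist_oct (h1 := 0 : mor B O) (h2 := 0) ds (dist_rot1 d).
  by rewrite -es; apply: dist_id.
exists C; split; last by exists s, p, q.
apply: (fobj_reflects_isomorphic shfK unshfK).
exists (fmap S p \oc - fmap S f).
exact: (dist_cocone0_iso (dist_rot1 duv) zO).
Qed.

(** ** Extension-closed hulls *)

Lemma extension_closed_iso (P : T -> Prop) :
  extension_closed P -> forall X Y, isomorphic X Y -> P X -> P Y.
Proof.
move=> [P0 Pext] X Y [f [g [gf fg]]] PX.
have [[O zO] _] := tri_additive T.
apply: (Pext _ _ _ f (0 : mor Y O) 0 _ PX (P0 _ zO)).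
apply: (dist_iso (b := f) (is_iso_id X) _ (is_iso_id O) _ _ _ (dist_id X zO)).
- by exists g.
- by [].
- by rewrite comp0l comp0r.
- by rewrite comp0l comp0r.
Qed.

Lemma extension_closed_star (P : T -> Prop) X :
  extension_closed P -> star P P X -> P X.
Proof.
by move=> [_ Pext] [A [B [f [g [h [d PA PB]]]]]]; apply: Pext d PA PB.
Qed.

Lemma ext_hull_closed (G : T -> Prop) : extension_closed (ext_hull G).
Proof.
split=> [Z z P [P0 _] _|A X B f g h d hA hB P Pc GP]; first exact: P0.
by apply: (proj2 Pc) d (hA P Pc GP) (hB P Pc GP).
Qed.

Lemma ext_hull_gen (G : T -> Prop) X : G X -> ext_hull G X.
Proof. by move=> GX P _; apply. Qed.

Lemma ext_hull_mono (G G' : T -> Prop) X :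
  (forall Y, G Y -> ext_hull G' Y) -> ext_hull G X -> ext_hull G' X.
Proof. by move=> GG; apply=> //; apply: ext_hull_closed. Qed.

(** Vanishing of maps between generators passes to the hulls, because both
   [mor _ Y] and [mor X _] are exact in the middle of a triangle. *)
Lemma no_mor_ext_hull (G H : T -> Prop) :
  (forall X Y, G X -> H Y -> no_mor X Y) ->
  forall X Y, ext_hull G X -> ext_hull H Y -> no_mor X Y.
Proof.
move=> GH X Y hX hY.
have GY W : G W -> no_mor W Y.
  move=> GW; apply: (hY (fun Y => no_mor W Y)) => [|Z HZ]; last exact: GH.
  split=> [Z z f|A Z B f g h d nA nB u]; first exact: (proj2 (z W)).
  by have [v ->] := dist_factor_in d (nB (g \oc u)); rewrite (nA v) comp0r.
apply: (hX (fun X => no_mor X Y)) => [|Z GZ]; last exact: GY.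
split=> [Z z f|A Z B f g h d nA nB u]; first exact: (proj1 (z Y)).
by have [v ->] := dist_factor_out d (nA (u \oc f)); rewrite (nB v) comp0l.
Qed.

(** * Exchanging two classes of generators *)

Section Exchange.
Variables H L : T -> Prop.
Hypothesis L_iso : forall X Y, isomorphic X Y -> L X -> L Y.
Hypothesis connecting : forall A B, L A -> H B -> mor0_or_iso B (S A).

(** Cancellation turns a factor in [L] into a zero object; admitting the zero
   objects keeps the class of right-hand factors stable. *)
Definition or_zero (P : T -> Prop) X := P X \/ is_zero X.

Lemma star_exchange_gen X :
  star (or_zero L) H X -> star (ext_hull H) (or_zero L) X.
Proof.
have hullP := ext_hull_closed H; have [[O zO] _] := tri_additive T.
move=> [A [B [f [g [h [d [LA|zA] HB]]]]]]; last first.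
  exists X, O, (idm X), 0, 0; split; [exact: dist_id| |by right].
  apply: (extension_closed_iso hullP _ (ext_hull_gen HB)).
  by apply: isomorphic_sym; exists g; apply: (dist_cocone0_iso d).
have [h0|ih] := connecting LA HB h; last first.
  have zX := dist_mor_iso_cone0 d ih.
  exists X, O, (idm X), 0, 0; split; [exact: dist_id| |by right].
  exact: (proj1 hullP).
rewrite h0 in d; have [C [AC [s [p [q ds]]]]] := dist_split_swap d.
exists B, C, s, p, q; split=> //; first exact: ext_hull_gen.
by left; apply: L_iso LA.
Qed.

(** A single factor from [L] moves to the right past an iterated extension [B].
   For [B] an extension of [E] by [C] it first passes [C], then [E], the product
   being reassociated in between. *)
Lemma star_exchange_right B : ext_hull H B -> forall X,
  star (or_zero L) (eq B) X -> star (ext_hull H) (or_zero L) X.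
Proof.
move=> /(_ (fun B => forall X,
  star (or_zero L) (eq B) X -> star (ext_hull H) (or_zero L) X)).
have hullP := ext_hull_closed H.
have eqstar C D E (P : T -> Prop) (f : mor C D) (g : mor D E) h X :
    dist f g h -> star P (eq D) X -> star P (star (eq C) (eq E)) X.
  by move=> d; apply: star_mono => // _ <-; exists C, E, f, g, h.
apply; [split=> [O zO X|C D E f g h d IC IE X] | move=> Y HY X XA]; last first.
- by apply: star_exchange_gen; apply: star_mono XA => // _ <-.
- move=> /(eqstar _ _ _ _ _ _ _ _ d)/star_assocr XE.
  have : star (ext_hull H) (star (or_zero L) (eq E)) X.
    by apply: star_assocl; apply: star_mono XE => // Y; apply: IC.
  move=> /(star_mono (fun _ => id) IE) /star_assocr.
  by apply: star_mono => // Y; apply: extension_closed_star.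
- move=> [A [Z [f [g [h [d LA eZ]]]]]]; rewrite {}eZ in zO.
  have iX : isomorphic A X by exists f; apply: (dist_cone0_iso d).
  exists Z, X, 0, (idm X), 0; split; first exact: dist_id0.
    exact: (proj1 hullP).
  case: LA => [LA|zA]; [left; exact: L_iso LA|right; exact: is_zero_iso zA].
Qed.

(** Induction on the left factor: for [A] an extension of [E] by [C], first
   [E], then [C], moves past [ext_hull H]. *)
Lemma star_exchange_left A : ext_hull L A -> forall X,
  star (eq A) (ext_hull H) X -> star (ext_hull H) (ext_hull L) X.
Proof.
move=> /(_ (fun A => forall X,
  star (eq A) (ext_hull H) X -> star (ext_hull H) (ext_hull L) X)).
have hullH := ext_hull_closed H; have hullL := ext_hull_closed L.
have [[O zO] _] := tri_additive T.
have or_zero_hull X : or_zero L X -> ext_hull L X.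
  by case=> [LX|zX]; [apply: ext_hull_gen|apply: (proj1 hullL)].
apply; [split=> [Z z X|C D E f g h d IC IE X] | move=> Y LY X]; last first.
- move=> [Z [B [f [g [h [d eZ HB]]]]]]; rewrite {}eZ in LY.
  apply: (star_mono (fun _ => id) or_zero_hull).
  by apply: (star_exchange_right HB); exists Z, B, f, g, h; split=> //; left.
- move=> XD.
  have : star (eq C) (star (eq E) (ext_hull H)) X.
    by apply/star_assocl; apply: star_mono XD => // _ <-; exists C, E, f, g, h.
  move=> /(star_mono (fun _ => id) IE) /star_assocr.
  move=> /(star_mono IC (fun _ => id)) /star_assocl.
  by apply: star_mono => // Y; apply: extension_closed_star.
- move=> [W [B [f [g [h [d eW HB]]]]]]; rewrite {}eW in z.
  exists X, O, (idm X), 0, 0; split; [exact: dist_id| |exact: (proj1 hullL)].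
  apply: (extension_closed_iso hullH _ HB).
  by apply: isomorphic_sym; exists g; apply: (dist_cocone0_iso d).
Qed.

(** The product (ext H) * (ext L) is extension-closed: writing [H], [L] for the
   closures, [H * L * H * L] is contained in [H * H * L * L], hence in
   [H * L]. *)
Lemma ext_hull_star X :
  ext_hull (fun Y => H Y \/ L Y) X -> star (ext_hull H) (ext_hull L) X.
Proof.
have hullH := ext_hull_closed H; have hullL := ext_hull_closed L.
have [[O zO] _] := tri_additive T.
have H0 := proj1 hullH; have L0 := proj1 hullL.
apply=> [|Y [HY|LY]]; last 2 first.
- exists Y, O, (idm Y), 0, 0; split; [exact: dist_id| |exact: L0].
  exact: ext_hull_gen.
- exists O, Y, 0, (idm Y), 0; split; [exact: dist_id0|exact: H0|].
  exact: ext_hull_gen.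
split=> [Z z|A Y B f g h d sA sB].
  by exists Z, Z, (idm Z), 0, 0; split; [exact: dist_id|exact: H0|exact: L0].
have /star_assocl : star (star (ext_hull H) (ext_hull L))
    (star (ext_hull H) (ext_hull L)) Y by exists A, B, f, g, h.
have swap Z : star (ext_hull L) (star (ext_hull H) (ext_hull L)) Z ->
    star (ext_hull H) (ext_hull L) Z.
  move=> /star_assocr XE.
  have : star (star (ext_hull H) (ext_hull L)) (ext_hull L) Z.
    apply: star_mono XE => // W [C [D [i [p [q [dW LC HD]]]]]].
    by apply: (star_exchange_left LC); exists C, D, i, p, q.
  move=> /star_assocl.
  by apply: star_mono => // W; apply: extension_closed_star.
move=> /(star_mono (fun _ => id) swap) /star_assocr.
by apply: star_mono => // W; apply: extension_closed_star.
Qed.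

End Exchange.

(** * Translates *)

Lemma sh_succ (k : int) X : isomorphic (S (sh k X)) (sh (k + 1) X).
Proof.
case: k => [m|m]; first by rewrite -PoszD addn1; apply: isomorphic_refl.
have -> : Negz m + 1 = - m%:Z by lia.
by case: m => [|m]; apply: (left_quasi_inverse_iso unshfK).
Qed.

Lemma sh_pred (k : int) X : isomorphic (U (sh k X)) (sh (k - 1) X).
Proof.
apply: (isomorphic_trans _ (left_quasi_inverse_iso shfK _)).
apply: fobj_isomorphic; apply: isomorphic_sym.
by have := sh_succ (k - 1) X; rewrite subrK.
Qed.

(** [Hom(A[k], B[l]) = Hom(A, B[l - k])], phrased for relations so that it
   transports vanishing and invertibility alike. The translates of an object
   compose only up to isomorphism, whence the invariance of [R]. *)
Lemma shf_closed_sh_rel (R : T -> T -> Prop) :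
  (forall A A' B B', isomorphic A A' -> isomorphic B B' -> R A B -> R A' B') ->
  (forall A B, R A B -> R (S A) (S B)) ->
  (forall A B, R A B -> R (U A) (U B)) ->
  forall (k l : int) A B, R A (sh (l - k) B) -> R (sh k A) (sh l B).
Proof.
move=> Riso RS RU k l A B; case: k => m.
  elim: m l => [|m IH] l; first by rewrite subr0.
  have -> : l - m.+1%:Z = l - 1 - m%:Z by lia.
  move=> /IH/RS; apply: Riso; first exact: isomorphic_refl.
  by have := sh_succ (l - 1) B; rewrite subrK.
elim: m l => [|m IH] l.
  have -> : l - Negz 0 = l + 1 by lia.
  move=> /RU; apply: Riso; first exact: isomorphic_refl.
  by have := sh_pred (l + 1) B; rewrite addrK.
have -> : l - Negz m.+1 = l + 1 - Negz m by lia.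
move=> /IH/RU; apply: Riso; first exact: isomorphic_refl.
by have := sh_pred (l + 1) B; rewrite addrK.
Qed.

Lemma no_mor_sh (k l : int) A B :
  no_mor A (sh (l - k) B) -> no_mor (sh k A) (sh l B).
Proof.
apply: (shf_closed_sh_rel (R := fun A B => no_mor A B)).
- exact: no_mor_iso.
- exact: (no_mor_fobj shfK unshfK).
- exact: (no_mor_fobj unshfK shfK).
Qed.

Lemma mor0_or_iso_sh (k l : int) A B :
  mor0_or_iso A (sh (l - k) B) -> mor0_or_iso (sh k A) (sh l B).
Proof.
apply: (shf_closed_sh_rel (R := fun A B => mor0_or_iso A B)).
- exact: mor0_or_iso_iso.
- exact: (mor0_or_iso_fobj shfK unshfK).
- exact: (mor0_or_iso_fobj unshfK shfK).
Qed.

Lemma ext_hull_fobj (F : linEndofunctor T) (G G' : T -> Prop) :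
  (forall X Y Z (f : mor X Y) (g : mor Y Z) (h : mor Z (S X)),
     dist f g h -> exists h', dist (fmap F f) (fmap F g) h') ->
  (forall X, G X -> ext_hull G' (F X)) ->
  forall X, ext_hull G X -> ext_hull G' (F X).
Proof.
move=> Fdist GG X hX; apply: (hX (fun X => ext_hull G' (F X))) => //.
have [H0 Hext] := ext_hull_closed G'.
split=> [Z z|A Y B f g h d hA hB]; first by apply: H0; apply: fobj_zero.
by have [h' d'] := Fdist _ _ _ _ _ _ d; apply: Hext d' hA hB.
Qed.

Lemma exceptional_end A (f : mor A A) : exceptional A -> f = 0 \/ is_iso f.
Proof.
move=> [_ [phi [psi phiK _]]].
have phi_inj : injective phi := can_inj phiK.
have [id0|id_nz] := eqVneq (phi (idm A)) 0.
  left; rewrite -[f]comp_idr (_ : idm A = 0) ?comp0r //.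
  by apply: phi_inj; rewrite id0 linear0.
have ef : f = (phi f / phi (idm A)) *: idm A.
  apply: phi_inj; rewrite linearZ /=.
  by rewrite /GRing.scale /= divfK.
have [f0|f_nz] := eqVneq (phi f) 0; first by left; rewrite ef f0 mul0r scale0r.
right; rewrite ef; apply: is_isoZ; last exact: is_iso_id.
by rewrite mulf_neq0 // invr_eq0.
Qed.

(** * The bounded t-structure *)

Section Collection.
Variables (n : nat) (E : 'I_n.+1 -> T).
Implicit Types D : pred int.

Definition translate_in D X :=
  exists (k : int) i, D k /\ isomorphic (sh k (E i)) X.

Definition hull D := ext_hull (translate_in D).

Lemma translate_in_iso D X Y :
  isomorphic X Y -> translate_in D X -> translate_in D Y.
Proof.
move=> XY [k [i [Dk kX]]]; exists k, i; split=> //.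
exact: isomorphic_trans XY.
Qed.

Lemma hull_iso D X Y : isomorphic X Y -> hull D X -> hull D Y.
Proof. exact: (extension_closed_iso (ext_hull_closed _)). Qed.

Lemma hull_mono D D' X : (forall k, D k -> D' k) -> hull D X -> hull D' X.
Proof.
move=> DD; apply: ext_hull_mono => Y [k [i [Dk kX]]].
by apply: ext_hull_gen; exists k, i; split=> //; apply: DD.
Qed.

Lemma hull_shf D X : hull D X -> hull (fun k => D (k - 1)) (S X).
Proof.
apply: ext_hull_fobj => [A Y B f g h d|Y [k [i [Dk kY]]]].
  by exists (- fmap S h); apply: dist_shf.
apply: ext_hull_gen; exists (k + 1), i; split; first by rewrite addrK.
exact: isomorphic_trans (isomorphic_sym (sh_succ _ _)) (fobj_isomorphic S kY).
Qed.

Lemma hull_unshf D X : hull D X -> hull (fun k => D (k + 1)) (U X).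
Proof.
apply: ext_hull_fobj => [A Y B f g h d|Y [k [i [Dk kY]]]].
  exact: dist_unshf d.
apply: ext_hull_gen; exists (k - 1), i; split; first by rewrite subrK.
exact: isomorphic_trans (isomorphic_sym (sh_pred _ _)) (fobj_isomorphic U kY).
Qed.

Lemma hull_of_shf D X : hull D (S X) -> hull (fun k => D (k + 1)) X.
Proof.
by move=> /hull_unshf; apply: hull_iso; apply: (left_quasi_inverse_iso shfK).
Qed.

Lemma hull_sh D (m : int) X : hull D X -> hull (fun k => D (k - m)) (sh m X).
Proof.
move=> hX; case: m => m.
  elim: m => [|m /hull_shf]; first by apply: hull_mono hX => k; rewrite subr0.
  by apply: hull_mono => k /=; congr (D _); lia.
elim: m => [|m /hull_unshf]; first move: hX => /hull_unshf.
all: by apply: hull_mono => k /=; congr (D _); lia.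
Qed.

Section ExtExceptional.
Hypothesis E_ext : ext_exceptional_collection E.

Lemma translates_mor0_or_iso D D' X Y :
  (forall k l, D k -> D' l -> l <= k) ->
  translate_in D X -> translate_in D' Y -> mor0_or_iso X Y.
Proof.
move=> DD [k [i [Dk kX]]] [l [j [Dl lY]]].
have [[E_exc _] E_neg] := E_ext.
apply: (mor0_or_iso_iso kX lY); apply: mor0_or_iso_sh.
have := DD k l Dk Dl => lk.
have [<-|ij] := eqVneq i j; last by move=> f; left; apply: E_neg; lia.
have [lk0|lk0] := eqVneq (l - k) 0; last first.
  by move=> f; left; apply: (proj1 (E_exc i)).
by rewrite lk0 => f; apply: exceptional_end.
Qed.

Lemma translates_no_mor D D' X Y :
  (forall k l, D k -> D' l -> l < k) ->
  translate_in D X -> translate_in D' Y -> no_mor X Y.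
Proof.
move=> DD [k [i [Dk kX]]] [l [j [Dl lY]]].
have [[E_exc _] E_neg] := E_ext.
apply: (no_mor_iso kX lY); apply: no_mor_sh.
have := DD k l Dk Dl => lk.
have [<-|ij] := eqVneq i j; last by apply: E_neg; lia.
by apply: (proj1 (E_exc i)); lia.
Qed.

Lemma hull_no_mor D D' X Y :
  (forall k l, D k -> D' l -> l < k) -> hull D X -> hull D' Y -> no_mor X Y.
Proof.
by move=> DD; apply: no_mor_ext_hull => A B; apply: translates_no_mor.
Qed.

(** The exchange applies when [l < k]: the connecting map then goes from a
   translate by [k] to a translate by [l + 1 <= k]. *)
Lemma hull_star D D' X :
  (forall k l, D k -> D' l -> l < k) ->
  hull (fun k => D k || D' k) X -> star (hull D) (hull D') X.
Proof.
move=> DD hX.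
apply: (ext_hull_star (H := translate_in D) (L := translate_in D')).
- by move=> Y Z; apply: translate_in_iso.
- move=> A B [l [j [Dl lA]]] HB.
  apply: (translates_mor0_or_iso (D' := pred1 (l + 1))) HB _.
    by move=> k _ Dk /eqP ->; have := DD k l Dk Dl; lia.
  exists (l + 1), j; split; first exact: eqxx.
  exact: isomorphic_trans (isomorphic_sym (sh_succ _ _)) (fobj_isomorphic S lA).
- apply: ext_hull_mono hX => Y [k [i [Dk kY]]]; apply: ext_hull_gen.
  by case/orP: Dk => Dk; [left|right]; exists k, i.
Qed.

Lemma hull0_members X : hull (pred1 0) X <-> ext_hull (members E) X.
Proof.
split; apply: ext_hull_mono => Y.
  move=> [k [i [/eqP -> kY]]].
  apply: (extension_closed_iso (ext_hull_closed _) kY).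
  by apply: ext_hull_gen; exists i.
move=> [i ->]; apply: ext_hull_gen; exists 0, i; split=> //.
exact: isomorphic_refl.
Qed.

Lemma hull_heart X :
  hull (fun k => 0 <= k) X -> hull (fun k => k <= 0) X -> hull (pred1 0) X.
Proof.
move=> X_ge X_le.
have [||A [B [f [g [h [d hA hB]]]]]] :=
    hull_star (D := fun k => 1 <= k) (D' := pred1 0) (X := X).
- by move=> k l ? /eqP ->; lia.
- by apply: hull_mono X_ge => k /=; lia.
have f0 : f = 0 by apply: (hull_no_mor _ hA X_le) => k l *; lia.
(* As [f = 0], rotation makes [S A] a direct summand of [B], but there is no
   nonzero map from [S A], built from translates by [k >= 2], to [B]. *)
have [|v e] := dist_factor_in (u := idm (S A)) (dist_rot1 (dist_rot1 d)).
  by rewrite f0 fmap0 oppr0 comp0l.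
have zA : is_zero A.
  apply: (fobj_reflects_zero shfK); apply: is_zero_id.
  rewrite e (_ : v = 0) ?comp0r //.
  apply: (hull_no_mor _ (hull_shf hA) hB) => k l ? /eqP ->; lia.
apply: hull_iso hB; apply: isomorphic_sym; exists g.
exact: (dist_cocone0_iso d).
Qed.

Section Complete.
Hypothesis E_complete : complete_collection E.

Lemma hull_total X : hull predT X.
Proof.
apply: E_complete; first exact: ext_hull_closed.
  by move=> k Y /(hull_sh (m := k)).
move=> _ [i ->]; apply: ext_hull_gen; exists 0, i; split=> //.
exact: isomorphic_refl.
Qed.

Lemma hull_bounded X : exists N : nat, hull (fun k => - N%:Z <= k <= N%:Z) X.
Proof.
apply: (@hull_total X (fun Y => exists N : nat,
  hull (fun k => - N%:Z <= k <= N%:Z) Y)).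
  split=> [Z z|A Y B f g h d [a hA] [b hB]].
    by exists 0%N; apply: (proj1 (ext_hull_closed _)).
  exists (a + b)%N; apply: (proj2 (ext_hull_closed _) _ _ _ _ _ _ d).
    by apply: hull_mono hA => k /=; lia.
  by apply: hull_mono hB => k /=; lia.
move=> Y [k [i [_ kY]]]; exists `|k|%N; apply: ext_hull_gen.
by exists k, i; split=> //; lia.
Qed.

Lemma collection_t_structure :
  exists t : t_structure T,
    (forall X, tle0 t X <-> hull (fun k => 0 <= k) X) /\
    (forall X, tge0 t X <-> hull (fun k => k <= 0) X).
Proof.
unshelve eexists (@TStructure _ T (hull (fun k => 0 <= k))
  (hull (fun k => k <= 0)) _ _ _ _ _ _); last by [].
- by move=> X Y f fi; apply: hull_iso; exists f.
- by move=> X Y f fi; apply: hull_iso; exists f.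
- by move=> X /hull_shf; apply: hull_mono => k /=; lia.
- by move=> X /hull_of_shf; apply: hull_mono => k /=; lia.
- move=> X Y hX /hull_of_shf hY; apply: (hull_no_mor _ hX hY) => k l /=; lia.
move=> X; have [||A [B [f [g [h [d hA hB]]]]]] :=
    hull_star (D := fun k => 0 <= k) (D' := fun k => k < 0) (X := X).
- by move=> k l /=; lia.
- by apply: hull_mono (hull_total X) => k /=; lia.
exists A, B, f, g, h; split=> //.
by move: hB => /hull_shf; apply: hull_mono => k /=; lia.
Qed.

End Complete.
End ExtExceptional.
End Collection.
End Triangulated.

Theorem lemma3p14 (R : realType) (T : triCat R[i]) (n : nat)
    (E : 'I_n.+1 -> T) :
  finite_type T ->
  ext_exceptional_collection E ->
  complete_collection E ->
  is_bounded_heart (ext_hull (members E)).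
Proof.
move=> _ E_ext E_complete.
have [t [tle tge]] := collection_t_structure E_ext E_complete.
exists t; split=> X.
  have [N hX] := hull_bounded E_complete X.
  exists (- N%:Z), N%:Z; split; [apply/tge|apply/tle].
    by apply: hull_mono (hull_sh (m := - N%:Z) hX) => k /=; lia.
  by apply: hull_mono (hull_sh (m := N%:Z) hX) => k /=; lia.
rewrite -hull0_members.
split=> [hX|[/tle X_ge /tge X_le]]; last exact: hull_heart.
by split; [apply/tle|apply/tge]; apply: hull_mono hX => k /eqP ->.
Qed.
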